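(* Let $c>0$, $g\in C^2(\mathbb{R})$, $h\in C^1(\mathbb{R})$, $f\in C^1(0,+\infty)$, and consider the Neumann problem $$u_{tt}-c^2u_{xx}=0\ (x>0,\ t>0),\quad u(x,0)=g(x),\ u_t(x,0)=h(x)\ (x>0),\quad u_x(0,t)=f(t)\ (t>0).$$ The first partial derivatives $u_x$ and $u_t$ of the solution $u$ of this problem (given by the explicit formula in the context) are discontinuous across the characteristic line $t=x/c$, with the jumps given by $$[u_x]_{t=x/c}=-g'(0)+f(0)\qquad\text{and}\qquad [u_t]_{t=x/c}=c\,g'(0)-c\,f(0),$$ respectively, the jumps across the characteristic being determined by the initial data $g'(0)$ and the boundary data $f(0)$.
   Context: Domains: $D^+=\{(x,t): x>ct,\ t>0\}$ and $D^-=\{(x,t): 0<x<ct,\ t>0\}$, separated by the characteristic line $x-ct=0$. The solution of the Neumann problem is the function obtained from d'Alembert's formula: $$u(x,t)=\tfrac12[g(x+ct)+g(x-ct)]+\tfrac1{2c}\int_{x-ct}^{x+ct}h(\xi)\,d\xi,\quad (x,t)\in D^+,$$ $$u(x,t)=\tfrac12[g(x+ct)+g(-x+ct)]+\tfrac1{2c}\Big[\int_0^{x+ct}h(\xi)\,d\xi+\int_0^{ct-x}h(\xi)\,d\xi\Big]-c\int_0^{t-x/c}f(\xi)\,d\xi,\quad (x,t)\in D^-.$$ For $w=u_x$ or $w=u_t$, the jump across the line is $[w]_{t=x/c}:=w(x,x/c)_{(x,t)\in D^-}-w(x,x/c)_{(x,t)\in D^+}$, where the subscripts indicate that the value on the line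 $t=x/c$ is taken from the $D^-$ side (derivative of the second formula) and from the $D^+$ side (derivative of the first formula), respectively. $f(0)$ is the value of the boundary data at $t=0$.
   Formalization: Discontinuity of u_x and u_t is asserted only when f(0) ≠ g'(0), since otherwise both jumps vanish (e.g. g=h=f=0); and f is assumed right-continuous at 0 with value f(0), without which f(0) is not determined by f on (0,+∞) and the jump formulas can fail. *)

(* Defs.v *)
From Stdlib Require Import Reals.
From Coquelicot Require Import Coquelicot.
Open Scope R_scope.

Definition C1_on (D : R -> Prop) (f : R -> R) : Prop :=
  forall x, D x -> ex_derive f x /\ continuous (Derive f) x.

Definition C2_on (D : R -> Prop) (f : R -> R) : Prop :=
  C1_on D f /\ C1_on D (Derive f).

(* [f] is C^1 on (0,+oo) and [f 0] is its boundary value at 0; nothing is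
   assumed about [f] at negative arguments, nor about [f'] near 0. *)
Definition boundary_data (f : R -> R) : Prop :=
  C1_on (fun t => 0 < t) f /\ filterlim f (at_right 0) (locally (f 0)).

(* Functions of (x, t) are curried, position first. *)
Definition dx (u : R -> R -> R) (x t : R) : R := Derive (fun y => u y t) x.
Definition dt (u : R -> R -> R) (x t : R) : R := Derive (fun s => u x s) t.

Definition Dplus (c : R) (p : R * R) : Prop := c * snd p < fst p /\ 0 < snd p.
Definition Dminus (c : R) (p : R * R) : Prop :=
  0 < fst p < c * snd p /\ 0 < snd p.

Definition u_plus (c : R) (g h : R -> R) (x t : R) : R :=
  / 2 * (g (x + c * t) + g (x - c * t))
  + / (2 * c) * RInt h (x - c * t) (x + c * t).

Definition u_minus (c : R) (g h f : R -> R) (x t : R) : R :=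
  / 2 * (g (x + c * t) + g (- x + c * t))
  + / (2 * c) * (RInt h 0 (x + c * t) + RInt h 0 (c * t - x))
  - c * RInt f 0 (t - x / c).

(* The two formulas agree on the line x = c t, so the branch chosen there is
   immaterial; on the axes t = 0 < x and x = 0 < t this is the formula of the
   adjacent domain. *)
Definition neumann_sol (c : R) (g h f : R -> R) (x t : R) : R :=
  if Rlt_dec (c * t) x then u_plus c g h x t else u_minus c g h f x t.

(* The PDE holds classically off the characteristic x = c t, across which [u]
   is only required to be continuous. Derivatives on the axes are one-sided,
   taken from inside the quadrant. The conditions [ex_derive] make the total
   operator [Derive] meaningful. *)
Definition solves_neumann (c : R) (g h f : R -> R) (u : R -> R -> R) : Prop :=
  (forall x t, 0 < x -> 0 < t ->
     continuous (fun p : R * R => u (fst p) (snd p)) (x, t)) /\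
  (forall x t, Dplus c (x, t) \/ Dminus c (x, t) ->
     ex_derive (fun y => u y t) x /\ ex_derive (fun s => u x s) t /\
     ex_derive (fun y => dx u y t) x /\ ex_derive (fun s => dt u x s) t /\
     dt (dt u) x t - c ^ 2 * dx (dx u) x t = 0) /\
  (forall x, 0 < x ->
     u x 0 = g x /\
     filterlim (fun t => (u x t - u x 0) / t) (at_right 0) (locally (h x))) /\
  (forall t, 0 < t ->
     filterlim (fun x => (u x t - u 0 t) / x) (at_right 0) (locally (f t))).

(* The value of [w] at the point (x, x/c) taken from the side [D]. *)
Definition is_trace (D : R * R -> Prop) (c : R) (w : R -> R -> R)
    (x l : R) : Prop :=
  filterlim (fun p : R * R => w (fst p) (snd p))
    (within D (locally (x, x / c))) (locally l).

Definition is_jump (c : R) (w : R -> R -> R) (x j : R) : Prop :=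
  exists lm lp : R,
    is_trace (Dminus c) c w x lm /\ is_trace (Dplus c) c w x lp /\
    j = lm - lp.

(* No value assigned to [w] at (x, x/c) makes it continuous there. *)
Definition discontinuous_across (c : R) (w : R -> R -> R) (x : R) : Prop :=
  ~ exists l : R, is_trace (fun p => Dminus c p \/ Dplus c p) c w x l.

(* Main.v *)
Require Import Defs.
From Stdlib Require Import Reals Lra FunctionalExtensionality.
From Coquelicot Require Import Coquelicot.
Open Scope R_scope.

(** Both branches of the solution are one superposition of travelling waves
    [F (x + c t) + W (x - c t)]. With [H] the primitive of [h] vanishing at 0
    and [Phi] that of [f], the left-going profile
      [F s = g s / 2 + H s / (2 c)]
    is the same C^2 function on both sides of the characteristic, and the
    right-going profile is
      [W s = g s / 2 - H s / (2 c)]        for [0 < s] (set by the initial data),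
      [W s = F (- s) - c Phi (- s / c)]    for [s <= 0] (reflected at [x = 0]).

    Hence all the singular behaviour sits at the single point [s = 0] of [W].
    The two pieces agree there, both having the value [g 0 / 2], so [u] is
    continuous; away from [s = 0] the profile is twice differentiable, and any
    such superposition solves the wave equation ([wave_equation]). Since
    [u_x = F' + W'] and [u_t = c F' - c W'], and [F'] is continuous, the jump
    of [u_x] is [W'(0-) - W'(0+)] and that of [u_t] is [- c] times it
    ([wave_jump]). The formulas for the two pieces give
      [W'(0+) = g'(0) / 2 - h(0) / (2 c)],
      [W'(0-) = - g'(0) / 2 - h(0) / (2 c) + f(0)],
    whose difference is [f(0) - g'(0)]. A nonzero jump excludes a common limit
    from the two sides ([jump_discontinuous]).

    The boundary data are only continuous from the right at 0; prolonging them
    by the constant [f 0] to negative times gives a function that is continuous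
    on the whole line, without changing the integrals that occur. *)

(** * Functions glued at the origin *)

(** The prolonged boundary data, the right-going profile and its successive
    derivatives are all of this form. *)
Definition glue (A B : R -> R) (s : R) : R :=
  if Rlt_dec 0 s then A s else B s.

Lemma glue_pos A B s : 0 < s -> glue A B s = A s.
Proof. intros Hs; unfold glue; destruct (Rlt_dec 0 s); [easy | lra]. Qed.

Lemma glue_nonpos A B s : s <= 0 -> glue A B s = B s.
Proof. intros Hs; unfold glue; destruct (Rlt_dec 0 s); [lra | easy]. Qed.

Lemma locally_pos s : 0 < s -> locally s (fun y => 0 < y).
Proof. intros Hs; apply (open_gt 0 s Hs). Qed.

Lemma locally_neg s : s < 0 -> locally s (fun y => y < 0).
Proof. intros Hs; apply (open_lt 0 s Hs). Qed.

Lemma is_derive_glue (A B A' B' : R -> R) :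
  (forall s, 0 < s -> is_derive A s (A' s)) ->
  (forall s, s < 0 -> is_derive B s (B' s)) ->
  forall s, s <> 0 -> is_derive (glue A B) s (glue A' B' s).
Proof.
intros HA HB s Hs.
destruct (Rtotal_order s 0) as [Hn | [H0 | Hp]]; [| lra |].
- rewrite glue_nonpos by lra.
  apply (is_derive_ext_loc B); [| now apply HB].
  generalize (locally_neg s Hn); apply filter_imp; intros y Hy.
  symmetry; apply glue_nonpos; lra.
- rewrite glue_pos by lra.
  apply (is_derive_ext_loc A); [| now apply HA].
  generalize (locally_pos s Hp); apply filter_imp; intros y Hy.
  now symmetry; apply glue_pos.
Qed.

Lemma glue_at_right (A B : R -> R) (l : R) :
  filterlim A (at_right 0) (locally l) ->
  filterlim (glue A B) (at_right 0) (locally l).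
Proof.
apply filterlim_ext_loc.
unfold at_right, within; apply filter_forall.
intros s Hs; now symmetry; apply glue_pos.
Qed.

Lemma glue_at_left (A B : R -> R) :
  continuous B 0 -> filterlim (glue A B) (at_left 0) (locally (B 0)).
Proof.
intros HB.
apply (filterlim_ext_loc B).
- unfold at_left, within; apply filter_forall.
  intros s Hs; symmetry; apply glue_nonpos; lra.
- exact (filterlim_filter_le_1 _ (filter_le_within _) HB).
Qed.

Lemma continuous_glue (A B : R -> R) :
  (forall s : R, 0 < s -> continuous A s) ->
  (forall s : R, continuous B s) ->
  filterlim A (at_right 0) (locally (B 0)) ->
  forall s : R, continuous (glue A B) s.
Proof.
intros HA HB H0 s.
destruct (Rtotal_order s 0) as [Hn | [-> | Hp]].
- apply (continuous_ext_loc _ B); [| now apply HB].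
  generalize (locally_neg s Hn); apply filter_imp; intros y Hy.
  symmetry; apply glue_nonpos; lra.
- intros P HP; rewrite glue_nonpos in HP by lra.
  assert (Hr := H0 P HP); assert (Hl := HB 0 P HP).
  unfold filtermap, at_right, within in Hr, Hl |- *.
  generalize (filter_and _ _ Hr Hl); apply filter_imp.
  clear Hr Hl; intros y [Hr Hl].
  destruct (Rlt_dec 0 y) as [Hy | Hy].
  + rewrite glue_pos by easy; now apply Hr.
  + rewrite glue_nonpos by lra; exact Hl.
- apply (continuous_ext_loc _ A); [| now apply HA].
  generalize (locally_pos s Hp); apply filter_imp; intros y Hy.
  now symmetry; apply glue_pos.
Qed.

(** * Superpositions of travelling waves *)

Definition wave (c : R) (F W : R -> R) (x t : R) : R :=
  F (x + c * t) + W (x - c * t).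

Lemma is_derive_wave_x c F W x t a b :
  is_derive F (x + c * t) a -> is_derive W (x - c * t) b ->
  is_derive (fun y => wave c F W y t) x (a + b).
Proof.
intros HF HW; unfold wave.
apply (is_derive_plus (fun y => F (y + c * t)) (fun y => W (y - c * t))).
- evar_last.
  + apply (is_derive_comp F (fun y => y + c * t)); [exact HF |].
    auto_derive; reflexivity.
  + apply Rmult_1_l.
- evar_last.
  + apply (is_derive_comp W (fun y => y - c * t)); [exact HW |].
    auto_derive; reflexivity.
  + apply Rmult_1_l.
Qed.

Lemma is_derive_wave_t c F W x t a b :
  is_derive F (x + c * t) a -> is_derive W (x - c * t) b ->
  is_derive (fun s => wave c F W x s) t (c * a + - c * b).
Proof.
intros HF HW; unfold wave.
apply (is_derive_plus (fun s => F (x + c * s)) (fun s => W (x - c * s))).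
- evar_last.
  + apply (is_derive_comp F (fun s => x + c * s)); [exact HF |].
    auto_derive; reflexivity.
  + unfold scal; simpl; unfold mult; simpl; ring.
- evar_last.
  + apply (is_derive_comp W (fun s => x - c * s)); [exact HW |].
    auto_derive; reflexivity.
  + unfold scal; simpl; unfold mult; simpl; ring.
Qed.

Lemma dx_wave c (F W F' W' : R -> R) (x t : R) :
  (forall s, is_derive F s (F' s)) ->
  (forall s, s <> 0 -> is_derive W s (W' s)) ->
  x - c * t <> 0 -> dx (wave c F W) x t = wave c F' W' x t.
Proof.
intros HF HW Hx.
apply is_derive_unique, is_derive_wave_x; [apply HF | now apply HW].
Qed.

Lemma dt_wave c (F W F' W' : R -> R) (x t : R) :
  (forall s, is_derive F s (F' s)) ->
  (forall s, s <> 0 -> is_derive W s (W' s)) ->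
  x - c * t <> 0 ->
  dt (wave c F W) x t =
  wave c (fun s => c * F' s) (fun s => - c * W' s) x t.
Proof.
intros HF HW Hx.
apply is_derive_unique, is_derive_wave_t; [apply HF | now apply HW].
Qed.

Lemma locally_neq0 (phi : R -> R) (a : R) :
  continuous phi a -> phi a <> 0 -> locally a (fun y => phi y <> 0).
Proof. intros Hphi Ha; exact (Hphi _ (open_neq 0 _ Ha)). Qed.

(** Two derivatives in [x] give [F'' + W''], two in [t] give
    [c^2 (F'' + W'')]. The first derivatives are themselves superpositions
    only off the characteristic, hence the localisation. *)
Lemma wave_equation c (F W F' W' F'' W'' : R -> R) (x t : R) :
  (forall s, is_derive F s (F' s)) ->
  (forall s, s <> 0 -> is_derive W s (W' s)) ->
  (forall s, is_derive F' s (F'' s)) ->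
  (forall s, s <> 0 -> is_derive W' s (W'' s)) ->
  x - c * t <> 0 ->
  let u := wave c F W in
  ex_derive (fun y => u y t) x /\ ex_derive (fun s => u x s) t /\
  ex_derive (fun y => dx u y t) x /\ ex_derive (fun s => dt u x s) t /\
  dt (dt u) x t - c ^ 2 * dx (dx u) x t = 0.
Proof.
intros HF HW HF' HW' Hx u.
assert (Hxx : is_derive (fun y => dx u y t) x
                (F'' (x + c * t) + W'' (x - c * t))).
{ apply (is_derive_ext_loc (fun y => wave c F' W' y t)).
  - assert (Hl : locally x (fun y => y - c * t <> 0)).
    { apply (locally_neq0 (fun y => y - c * t)); [| exact Hx].
      apply (ex_derive_continuous (fun y => y - c * t)); now auto_derive. }
    revert Hl; apply filter_imp; intros y Hy.
    now symmetry; apply dx_wave.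
  - apply is_derive_wave_x; [apply HF' | now apply HW']. }
assert (Htt : is_derive (fun s => dt u x s) t
                (c * (c * F'' (x + c * t)) + - c * (- c * W'' (x - c * t)))).
{ apply (is_derive_ext_loc
           (fun s => wave c (fun r => c * F' r) (fun r => - c * W' r) x s)).
  - assert (Hl : locally t (fun s => x - c * s <> 0)).
    { apply (locally_neq0 (fun s => x - c * s)); [| exact Hx].
      apply (ex_derive_continuous (fun s => x - c * s)); now auto_derive. }
    revert Hl; apply filter_imp; intros s Hs.
    now symmetry; apply dt_wave.
  - apply is_derive_wave_t.
    + apply (is_derive_scal F'), HF'.
    + apply (is_derive_scal W'); now apply HW'. }
split; [eexists; apply is_derive_wave_x; [apply HF | now apply HW] |].
split; [eexists; apply is_derive_wave_t; [apply HF | now apply HW] |].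
split; [eexists; exact Hxx |].
split; [eexists; exact Htt |].
assert (Ett : dt (dt u) x t = _) by exact (is_derive_unique _ _ _ Htt).
assert (Exx : dx (dx u) x t = _) by exact (is_derive_unique _ _ _ Hxx).
rewrite Ett, Exx; ring.
Qed.

Lemma continuous_left_phase c (p : R * R) :
  continuous (fun q : R * R => fst q + c * snd q) p.
Proof.
destruct p as [x t].
apply (continuous_plus (fun q : R * R => fst q) (fun q : R * R => c * snd q)).
- apply continuous_fst.
- apply (continuous_scal_r c (fun q : R * R => snd q)), continuous_snd.
Qed.

Lemma continuous_right_phase c (p : R * R) :
  continuous (fun q : R * R => fst q - c * snd q) p.
Proof.
destruct p as [x t].
apply (continuous_minus (fun q : R * R => fst q) (fun q : R * R => c * snd q)).
- apply continuous_fst.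
- apply (continuous_scal_r c (fun q : R * R => snd q)), continuous_snd.
Qed.

Lemma continuous_wave c F W (p : R * R) :
  (forall s, continuous F s) -> (forall s, continuous W s) ->
  continuous (fun q : R * R => wave c F W (fst q) (snd q)) p.
Proof.
intros HF HW; unfold wave.
apply (continuous_plus (fun q : R * R => F (fst q + c * snd q))
                       (fun q : R * R => W (fst q - c * snd q))).
- apply (continuous_comp (fun q : R * R => fst q + c * snd q) F).
  + apply continuous_left_phase.
  + apply HF.
- apply (continuous_comp (fun q : R * R => fst q - c * snd q) W).
  + apply continuous_right_phase.
  + apply HW.
Qed.

(** * Traces and jumps on the characteristic *)

Lemma is_trace_ext (D : R * R -> Prop) c w w' x l :
  (forall y t, D (y, t) -> w y t = w' y t) ->
  is_trace D c w x l -> is_trace D c w' x l.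
Proof.
intros Hw; apply filterlim_within_ext.
intros [y t]; apply Hw.
Qed.

Lemma is_trace_subset (D E : R * R -> Prop) c w x l :
  (forall p, D p -> E p) -> is_trace E c w x l -> is_trace D c w x l.
Proof.
intros HDE; apply filterlim_filter_le_1.
intros P HP; unfold within in HP |- *.
revert HP; apply filter_imp; auto.
Qed.

(** On a side [D] of the characteristic, where the phase [x - c t] tends to 0
    within [E], a one-sided limit of [W] at 0 becomes a trace. *)
Lemma is_trace_wave (D : R * R -> Prop) (E : R -> Prop) c (F W : R -> R)
    (x l : R) :
  c <> 0 ->
  (forall p, D p -> E (fst p - c * snd p)) ->
  continuous F (2 * x) ->
  filterlim W (within E (locally 0)) (locally l) ->
  is_trace D c (wave c F W) x (F (2 * x) + l).
Proof.
intros Hc HDE HF HW.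
assert (Hl : x + c * (x / c) = 2 * x) by now field.
assert (Hr : x - c * (x / c) = 0) by now field.
apply (filterlim_comp_2 (G := locally (F (2 * x))) (H := locally l)
         (fun p : R * R => F (fst p + c * snd p))
         (fun p : R * R => W (fst p - c * snd p)) Rplus).
- apply (filterlim_filter_le_1 _ (filter_le_within _)).
  rewrite <- Hl in HF |- *.
  exact (continuous_comp (fun p : R * R => fst p + c * snd p) F (x, x / c)
           (continuous_left_phase c _) HF).
- intros P HP; apply HW in HP; unfold within in HP.
  rewrite <- Hr in HP.
  apply (continuous_right_phase c (x, x / c)) in HP.
  unfold filtermap, within in HP |- *.
  revert HP; apply filter_imp; intros p HP Hp.
  now apply HP, HDE.
- apply (filterlim_plus (F (2 * x)) l).
Qed.

Lemma Dplus_phase c p : Dplus c p -> 0 < fst p - c * snd p.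
Proof. unfold Dplus; lra. Qed.

Lemma Dminus_phase c p : Defs.Dminus c p -> fst p - c * snd p < 0.
Proof. unfold Defs.Dminus; lra. Qed.

Lemma wave_jump c (F W F' W' : R -> R) (lm lp x : R) :
  c <> 0 ->
  (forall s, is_derive F s (F' s)) ->
  (forall s, s <> 0 -> is_derive W s (W' s)) ->
  (forall s, continuous F' s) ->
  filterlim W' (at_left 0) (locally lm) ->
  filterlim W' (at_right 0) (locally lp) ->
  is_jump c (dx (wave c F W)) x (lm - lp) /\
  is_jump c (dt (wave c F W)) x (- c * (lm - lp)).
Proof.
intros Hc HF HW HF' Hm Hp; split.
- exists (F' (2 * x) + lm), (F' (2 * x) + lp); split; [| split].
  + apply (is_trace_ext _ c (wave c F' W')).
    { intros y t Hyt; apply Dminus_phase in Hyt; simpl in Hyt.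
      symmetry; apply dx_wave; auto; lra. }
    apply (is_trace_wave (Defs.Dminus c) (fun s => s < 0));
      auto using Dminus_phase.
  + apply (is_trace_ext _ c (wave c F' W')).
    { intros y t Hyt; apply Dplus_phase in Hyt; simpl in Hyt.
      symmetry; apply dx_wave; auto; lra. }
    apply (is_trace_wave (Dplus c) (fun s => 0 < s)); auto using Dplus_phase.
  + ring.
- exists (c * F' (2 * x) + - c * lm), (c * F' (2 * x) + - c * lp).
  assert (HcF : continuous (fun s => c * F' s) (2 * x))
    by apply (continuous_scal_r c F'), HF'.
  assert (HcW : forall G {FG : Filter G} l, filterlim W' G (locally l) ->
            filterlim (fun s => - c * W' s) G (locally (- c * l))).
  { intros G FG l HG.
    apply (filterlim_comp _ _ _ W' (fun r => - c * r) _ _ _ HG).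
    apply (filterlim_scal_r (- c) l). }
  split; [| split].
  + apply (is_trace_ext _ c
             (wave c (fun s => c * F' s) (fun s => - c * W' s))).
    { intros y t Hyt; apply Dminus_phase in Hyt; simpl in Hyt.
      symmetry; apply dt_wave; auto; lra. }
    apply (is_trace_wave (Defs.Dminus c) (fun s => s < 0) c (fun s => c * F' s));
      auto using Dminus_phase.
    apply HcW; [apply within_filter, locally_filter | exact Hm].
  + apply (is_trace_ext _ c
             (wave c (fun s => c * F' s) (fun s => - c * W' s))).
    { intros y t Hyt; apply Dplus_phase in Hyt; simpl in Hyt.
      symmetry; apply dt_wave; auto; lra. }
    apply (is_trace_wave (Dplus c) (fun s => 0 < s) c (fun s => c * F' s));
      auto using Dplus_phase.
    apply HcW; [apply within_filter, locally_filter | exact Hp].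
  + ring.
Qed.

(** Every neighbourhood of a point of the characteristic meets both domains:
    move vertically, up into [Dminus] and down into [Dplus]. *)
Lemma proper_within_Dminus c x :
  0 < c -> 0 < x -> ProperFilter' (within (Defs.Dminus c) (locally (x, x / c))).
Proof.
intros Hc Hx; split; [| apply within_filter, locally_filter].
intros [eps He].
assert (Heps := cond_pos eps).
assert (Hxc : 0 < x / c) by now apply Rdiv_lt_0_compat.
assert (Hcx : c * (x / c) = x) by (field; lra).
apply (He (x, x / c + eps / 2)).
- split; [apply ball_center |]; simpl.
  unfold ball; simpl; unfold AbsRing_ball, abs, minus, plus, opp; simpl.
  apply Rabs_def1; lra.
- unfold Defs.Dminus; simpl; nra.
Qed.

Lemma proper_within_Dplus c x :
  0 < c -> 0 < x -> ProperFilter' (within (Dplus c) (locally (x, x / c))).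
Proof.
intros Hc Hx; split; [| apply within_filter, locally_filter].
intros [eps He].
assert (Heps := cond_pos eps).
assert (Hxc : 0 < x / c) by now apply Rdiv_lt_0_compat.
assert (Hcx : c * (x / c) = x) by (field; lra).
set (d := Rmin eps (x / c) / 2).
assert (Hd : 0 < d /\ d < eps /\ d < x / c)
  by (unfold d, Rmin; destruct Rle_dec; lra).
apply (He (x, x / c - d)).
- split; [apply ball_center |]; simpl.
  unfold ball; simpl; unfold AbsRing_ball, abs, minus, plus, opp; simpl.
  apply Rabs_def1; lra.
- unfold Dplus; simpl; nra.
Qed.

Lemma jump_discontinuous c w x j :
  0 < c -> 0 < x -> is_jump c w x j -> j <> 0 ->
  discontinuous_across c w x.
Proof.
intros Hc Hx (lm & lp & Hm & Hp & Hj) Hj0 [l Hl].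
apply Hj0.
assert (Elm : lm = l).
{ apply (filterlim_locally_unique (FF := proper_within_Dminus c x Hc Hx)
           _ _ _ Hm).
  apply is_trace_subset with (2 := Hl); auto. }
assert (Elp : lp = l).
{ apply (filterlim_locally_unique (FF := proper_within_Dplus c x Hc Hx)
           _ _ _ Hp).
  apply is_trace_subset with (2 := Hl); auto. }
lra.
Qed.

(** * The profiles of the Neumann problem *)

Lemma is_derive_primitive (k : R -> R) (s : R) :
  (forall r, continuous k r) -> is_derive (RInt k 0) s (k s).
Proof.
intros Hk; apply (is_derive_RInt k (RInt k 0) 0 s); [| apply Hk].
apply filter_forall; intros r.
apply (RInt_correct k), ex_RInt_continuous; auto.
Qed.

Lemma is_derive_at_right (phi : R -> R) (a l : R) :
  is_derive phi a l ->
  filterlim (fun e => (phi (a + e) - phi a) / e) (at_right 0) (locally l).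
Proof.
intros Hphi; apply is_derive_Reals in Hphi.
apply filterlim_locally; intros eps.
destruct (Hphi eps (cond_pos eps)) as [delta Hdelta].
exists delta; intros e He Hpos.
apply Hdelta; [lra |].
replace e with (minus e 0) by (unfold minus, plus, opp; simpl; ring).
exact He.
Qed.

Definition prolonged (f : R -> R) : R -> R := glue f (fun _ => f 0).

Lemma continuous_prolonged f :
  boundary_data f -> forall s, continuous (prolonged f) s.
Proof.
intros [Hf Hf0]; apply continuous_glue; auto.
- intros s Hs; apply (ex_derive_continuous f), Hf, Hs.
- intros s; apply continuous_const.
Qed.

Lemma RInt_prolonged f r : 0 <= r -> RInt (prolonged f) 0 r = RInt f 0 r.
Proof.
intros Hr; apply RInt_ext; intros s.
rewrite Rmin_left by easy; intros Hs.
now apply glue_pos.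
Qed.

Definition left_profile (c : R) (g h : R -> R) (s : R) : R :=
  / 2 * g s + / (2 * c) * RInt h 0 s.

Definition direct_profile (c : R) (g h : R -> R) (s : R) : R :=
  / 2 * g s - / (2 * c) * RInt h 0 s.

Definition reflected_profile (c : R) (g h f : R -> R) (s : R) : R :=
  left_profile c g h (- s) - c * RInt (prolonged f) 0 (- s / c).

Definition right_profile (c : R) (g h f : R -> R) : R -> R :=
  glue (direct_profile c g h) (reflected_profile c g h f).

(** Splitting the integral of [h] at 0 separates the two phases. On the
    reflected side the upper limit [t - x / c] of the boundary integral is
    nonnegative, so the prolongation does not change it. *)
Lemma neumann_sol_wave c (g h f : R -> R) :
  0 < c -> (forall s : R, continuous h s) ->
  neumann_sol c g h f =
  wave c (left_profile c g h) (right_profile c g h f).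
Proof.
intros Hc Hh.
assert (Hint : forall a b, ex_RInt h a b)
  by (intros; apply (ex_RInt_continuous (V := R_CompleteNormedModule)); auto).
extensionality x; extensionality t.
unfold neumann_sol, wave, right_profile, glue.
destruct (Rlt_dec (c * t) x), (Rlt_dec 0 (x - c * t)); try lra.
- unfold u_plus, left_profile, direct_profile.
  rewrite <- (RInt_Chasles h (x - c * t) 0 (x + c * t)) by auto.
  rewrite <- (opp_RInt_swap h 0 (x - c * t)) by auto.
  unfold plus, opp; simpl; ring.
- unfold u_minus, reflected_profile, left_profile.
  rewrite RInt_prolonged.
  + replace (- (x - c * t) / c) with (t - x / c) by (field; lra).
    replace (- (x - c * t)) with (c * t - x) by ring.
    replace (- x + c * t) with (c * t - x) by ring.
    ring.
  + apply Rdiv_le_0_compat; lra.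
Qed.

Definition left_profile' (c : R) (g h : R -> R) (s : R) : R :=
  / 2 * Derive g s + / (2 * c) * h s.

Definition left_profile'' (c : R) (g h : R -> R) (s : R) : R :=
  / 2 * Derive (Derive g) s + / (2 * c) * Derive h s.

Definition direct_profile' (c : R) (g h : R -> R) (s : R) : R :=
  / 2 * Derive g s - / (2 * c) * h s.

Definition direct_profile'' (c : R) (g h : R -> R) (s : R) : R :=
  / 2 * Derive (Derive g) s - / (2 * c) * Derive h s.

Definition reflected_profile' (c : R) (g h f : R -> R) (s : R) : R :=
  - left_profile' c g h (- s) + prolonged f (- s / c).

Definition reflected_profile'' (c : R) (g h f : R -> R) (s : R) : R :=
  left_profile'' c g h (- s) - / c * Derive f (- s / c).

Section Profiles.

Variables (c : R) (g h f : R -> R).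
Hypothesis hc : 0 < c.
Hypothesis hg : C2_on (fun _ => True) g.
Hypothesis hh : C1_on (fun _ => True) h.
Hypothesis hf : boundary_data f.

Local Lemma g_derive s : is_derive g s (Derive g s).
Proof. now apply Derive_correct, hg. Qed.

Local Lemma g'_derive s : is_derive (Derive g) s (Derive (Derive g) s).
Proof. now apply Derive_correct, hg. Qed.

Local Lemma h_derive s : is_derive h s (Derive h s).
Proof. now apply Derive_correct, hh. Qed.

Local Lemma h_continuous s : continuous h s.
Proof. now apply (ex_derive_continuous h), hh. Qed.

Local Lemma H_derive s : is_derive (RInt h 0) s (h s).
Proof. apply is_derive_primitive, h_continuous. Qed.

Lemma is_derive_left_profile s :
  is_derive (left_profile c g h) s (left_profile' c g h s).
Proof.
apply (is_derive_plus (fun s => / 2 * g s) (fun s => / (2 * c) * RInt h 0 s)).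
- apply (is_derive_scal g), g_derive.
- apply (is_derive_scal (RInt h 0)), H_derive.
Qed.

Lemma is_derive_left_profile' s :
  is_derive (left_profile' c g h) s (left_profile'' c g h s).
Proof.
apply (is_derive_plus (fun s => / 2 * Derive g s) (fun s => / (2 * c) * h s)).
- apply (is_derive_scal (Derive g)), g'_derive.
- apply (is_derive_scal h), h_derive.
Qed.

Lemma is_derive_direct_profile s :
  is_derive (direct_profile c g h) s (direct_profile' c g h s).
Proof.
apply (is_derive_minus (fun s => / 2 * g s) (fun s => / (2 * c) * RInt h 0 s)).
- apply (is_derive_scal g), g_derive.
- apply (is_derive_scal (RInt h 0)), H_derive.
Qed.

Lemma is_derive_direct_profile' s :
  is_derive (direct_profile' c g h) s (direct_profile'' c g h s).
Proof.
apply (is_derive_minus (fun s => / 2 * Derive g s) (fun s => / (2 * c) * h s)).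
- apply (is_derive_scal (Derive g)), g'_derive.
- apply (is_derive_scal h), h_derive.
Qed.

Local Lemma is_derive_comp_opp (k : R -> R) s l :
  is_derive k (- s) l -> is_derive (fun r => k (- r)) s (- l).
Proof.
intros Hk; evar_last.
- apply (is_derive_comp k (fun r => - r)); [exact Hk |].
  auto_derive; reflexivity.
- unfold scal; simpl; unfold mult; simpl; ring.
Qed.

Local Lemma is_derive_comp_time (k : R -> R) s l :
  is_derive k (- s / c) l -> is_derive (fun r => k (- r / c)) s (- / c * l).
Proof.
intros Hk; evar_last.
- apply (is_derive_comp k (fun r => - r / c)); [exact Hk |].
  auto_derive; reflexivity.
- unfold scal; simpl; unfold mult; simpl; field; lra.
Qed.

(** Since the prolonged data are continuous, the reflected profile is
    differentiable on the whole line, including the matching point 0. *)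
Lemma is_derive_reflected_profile s :
  is_derive (reflected_profile c g h f) s (reflected_profile' c g h f s).
Proof.
evar_last.
- apply (is_derive_minus (fun r => left_profile c g h (- r))
           (fun r => c * RInt (prolonged f) 0 (- r / c))).
  + apply is_derive_comp_opp, is_derive_left_profile.
  + apply is_derive_scal, (is_derive_comp_time (RInt (prolonged f) 0)).
    apply is_derive_primitive, continuous_prolonged, hf.
- unfold reflected_profile', minus, plus, opp; simpl; field; lra.
Qed.

Lemma is_derive_reflected_profile' s :
  s < 0 ->
  is_derive (reflected_profile' c g h f) s (reflected_profile'' c g h f s).
Proof.
intros Hs.
assert (Hsc : 0 < - s / c) by (apply Rdiv_lt_0_compat; lra).
evar_last.
- apply (is_derive_plus (fun r => - left_profile' c g h (- r))
           (fun r => prolonged f (- r / c))).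
  + apply (is_derive_opp (fun r => left_profile' c g h (- r))).
    apply is_derive_comp_opp, is_derive_left_profile'.
  + apply is_derive_comp_time.
    apply (is_derive_ext_loc f).
    * generalize (locally_pos _ Hsc); apply filter_imp; intros y Hy.
      now symmetry; apply glue_pos.
    * apply Derive_correct; now apply hf.
- unfold reflected_profile'', plus, opp; simpl; ring.
Qed.

Lemma continuous_left_profile' s : continuous (left_profile' c g h) s.
Proof.
apply (ex_derive_continuous (left_profile' c g h)).
eexists; apply is_derive_left_profile'.
Qed.

Lemma continuous_direct_profile s : continuous (direct_profile c g h) s.
Proof.
apply (ex_derive_continuous (direct_profile c g h)).
eexists; apply is_derive_direct_profile.
Qed.

Lemma continuous_reflected_profile' s :
  continuous (reflected_profile' c g h f) s.
Proof.
apply (continuous_plus (fun r => - left_profile' c g h (- r))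
         (fun r => prolonged f (- r / c))).
- apply (continuous_opp (fun r => left_profile' c g h (- r))).
  apply (continuous_comp (fun r => - r)); [| apply continuous_left_profile'].
  apply (ex_derive_continuous (fun r => - r)); now auto_derive.
- apply (continuous_comp (fun r => - r / c) (prolonged f));
    [| apply continuous_prolonged, hf].
  apply (ex_derive_continuous (fun r => - r / c)); now auto_derive.
Qed.

(** The two pieces match at 0 because every integral vanishes there, leaving
    [g 0 / 2] in both. *)
Lemma continuous_right_profile s : continuous (right_profile c g h f) s.
Proof.
apply continuous_glue.
- intros r _; apply continuous_direct_profile.
- intros r; apply (ex_derive_continuous (reflected_profile c g h f)).
  eexists; apply is_derive_reflected_profile.
- replace (reflected_profile c g h f 0) with (direct_profile c g h 0).
  + apply (filterlim_filter_le_1 _ (filter_le_within _)).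
    apply continuous_direct_profile.
  + unfold reflected_profile, left_profile, direct_profile.
    replace (- 0 / c) with 0 by (field; lra).
    rewrite Ropp_0, !RInt_point; unfold zero; simpl; ring.
Qed.

Definition right_profile' : R -> R :=
  glue (direct_profile' c g h) (reflected_profile' c g h f).

Definition right_profile'' : R -> R :=
  glue (direct_profile'' c g h) (reflected_profile'' c g h f).

Lemma is_derive_right_profile s :
  s <> 0 -> is_derive (right_profile c g h f) s (right_profile' s).
Proof.
apply is_derive_glue; intros r _.
- apply is_derive_direct_profile.
- apply is_derive_reflected_profile.
Qed.

Lemma is_derive_right_profile' s :
  s <> 0 -> is_derive right_profile' s (right_profile'' s).
Proof.
apply is_derive_glue; intros r Hr.
- apply is_derive_direct_profile'.
- now apply is_derive_reflected_profile'.
Qed.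

(** At [t = 0] the phases coincide and only the direct profile is met, so [H]
    cancels in [u] and [g'] in [u_t]; at [x = 0] the reflected profile is met,
    and its two terms were chosen so that [F'] cancels in [u_x] and [f] is
    left. *)
Lemma neumann_solves : solves_neumann c g h f (neumann_sol c g h f).
Proof.
rewrite (neumann_sol_wave c g h f hc h_continuous).
split; [| split; [| split]].
- intros x t _ _.
  apply (continuous_wave c _ _ (x, t)); [| apply continuous_right_profile].
  intros s; apply (ex_derive_continuous (left_profile c g h)).
  eexists; apply is_derive_left_profile.
- intros x t Hxt.
  apply (wave_equation c _ _ (left_profile' c g h) right_profile'
           (left_profile'' c g h) right_profile'').
  + apply is_derive_left_profile.
  + apply is_derive_right_profile.
  + apply is_derive_left_profile'.
  + apply is_derive_right_profile'.
  + destruct Hxt as [Hxt | Hxt].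
    * apply Dplus_phase in Hxt; simpl in Hxt; lra.
    * apply Dminus_phase in Hxt; simpl in Hxt; lra.
- intros x Hx; split.
  + unfold wave, right_profile; rewrite glue_pos by lra.
    unfold left_profile, direct_profile.
    rewrite Rmult_0_r, Rplus_0_r, Rminus_0_r; field; lra.
  + apply (filterlim_ext (fun e : R =>
             (wave c (left_profile c g h) (right_profile c g h f) x (0 + e)
              - wave c (left_profile c g h) (right_profile c g h f) x 0) / e)).
    { intros e; now rewrite Rplus_0_l. }
    apply (is_derive_at_right
             (fun t => wave c (left_profile c g h) (right_profile c g h f) x t)
             0 (h x)).
    evar_last.
    * apply is_derive_wave_t; [apply is_derive_left_profile |].
      apply is_derive_right_profile; lra.
    * unfold right_profile'; rewrite glue_pos by lra.
      unfold left_profile', direct_profile'.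
      rewrite Rmult_0_r, Rplus_0_r, Rminus_0_r; field; lra.
- intros t Ht.
  assert (Hct : 0 < c * t) by now apply Rmult_lt_0_compat.
  apply (filterlim_ext (fun e : R =>
           (wave c (left_profile c g h) (right_profile c g h f) (0 + e) t
            - wave c (left_profile c g h) (right_profile c g h f) 0 t) / e)).
  { intros e; now rewrite Rplus_0_l. }
  apply (is_derive_at_right
           (fun x => wave c (left_profile c g h) (right_profile c g h f) x t)
           0 (f t)).
  evar_last.
  + apply is_derive_wave_x; [apply is_derive_left_profile |].
    apply is_derive_right_profile; lra.
  + unfold right_profile'; rewrite glue_nonpos by lra.
    unfold reflected_profile'.
    replace (- (0 - c * t) / c) with t by (field; lra).
    replace (- (0 - c * t)) with (0 + c * t) by ring.
    unfold prolonged; rewrite glue_pos by easy; ring.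
Qed.

Lemma neumann_jump x :
  is_jump c (dx (neumann_sol c g h f)) x (- Derive g 0 + f 0) /\
  is_jump c (dt (neumann_sol c g h f)) x (c * Derive g 0 - c * f 0).
Proof.
rewrite (neumann_sol_wave c g h f hc h_continuous).
assert (E : - Derive g 0 + f 0
            = reflected_profile' c g h f 0 - direct_profile' c g h 0).
{ unfold reflected_profile', direct_profile', left_profile', prolonged.
  replace (- 0 / c) with 0 by (field; lra).
  rewrite glue_nonpos, Ropp_0 by lra; field; lra. }
replace (c * Derive g 0 - c * f 0) with (- c * (- Derive g 0 + f 0)) by ring.
rewrite E.
apply wave_jump with (F' := left_profile' c g h) (W' := right_profile').
- lra.
- apply is_derive_left_profile.
- apply is_derive_right_profile.
- apply continuous_left_profile'.
- apply glue_at_left, continuous_reflected_profile'.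
- apply glue_at_right, (filterlim_filter_le_1 _ (filter_le_within _)).
  apply (ex_derive_continuous (direct_profile' c g h)).
  eexists; apply is_derive_direct_profile'.
Qed.

End Profiles.

Theorem proposition4 (c : R) (g h f : R -> R)
  (hc : 0 < c)
  (hg : C2_on (fun _ => True) g)
  (hh : C1_on (fun _ => True) h)
  (hf : boundary_data f) :
  let u := neumann_sol c g h f in
  solves_neumann c g h f u /\
  (forall x : R, 0 < x ->
     is_jump c (dx u) x (- Derive g 0 + f 0) /\
     is_jump c (dt u) x (c * Derive g 0 - c * f 0)) /\
  (f 0 <> Derive g 0 ->
   forall x : R, 0 < x ->
     discontinuous_across c (dx u) x /\ discontinuous_across c (dt u) x).
Proof.
intros u; split; [now apply neumann_solves | split].
- intros x _; now apply neumann_jump.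
- intros Hne x Hx.
  destruct (neumann_jump c g h f hc hg hh hf x) as [Jx Jt].
  split.
  + apply (jump_discontinuous c _ x _ hc Hx Jx); lra.
  + apply (jump_discontinuous c _ x _ hc Hx Jt).
    rewrite <- Rmult_minus_distr_l.
    apply Rmult_integral_contrapositive_currified; lra.
Qed.
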